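(* Let $f,g:\mathbb{R}^n\to\bar{\mathbb{R}}$ be proper convex functions and let $T_a:=T_a(\operatorname{dom}(f),\operatorname{dom}(g))$ be the affine joint supporting subspace of their effective domains. Then $$(f+g)^*=(f+\iota_{T_a})^*\,\square\,(g+\iota_{T_a})^*,$$ and the infimum in the infimal convolution is attained: for every $z\in\mathbb{R}^n$ there exist $u,v\in\mathbb{R}^n$ with $u+v=z$ and $\big((f+\iota_{T_a})^*\square(g+\iota_{T_a})^*\big)(z)=(f+\iota_{T_a})^*(u)+(g+\iota_{T_a})^*(v)$.
   Context: $\bar{\mathbb{R}}=\mathbb{R}\cup\{-\infty,\infty\}$. For convex $f:\mathbb{R}^n\to\bar{\mathbb{R}}$, $\operatorname{dom}(f)=\{x: f(x)\neq\infty\}$; $f$ is proper if it is nowhere $-\infty$ and $\operatorname{dom}(f)\ne\emptyset$. The convex conjugate is $f^*(y)=\sup_{x\in\mathbb{R}^n}\langle y,x\rangle-f(x)$. The infimal convolution is $(f\,\square\,g)(z)=\inf_{x+y=z} f(x)+g(y)$. For a set $S$, $\iota_S$ is the indicator function, $0$ on $S$ and $\infty$ off $S$. $A\pm B=\{a\pm b\mid a\in A,b\in B\}$. Faces: for $C\subseteq\mathbb{R}^n$ convex, a subset $F\subseteq C$ is a face of $C$ if for all $y,z\in C$, whenever the open segment $]y,z[ = [y,z]\setminus\{y,z\}$ meets $F$, both $y,z\in F$. For $S\subseteq C$, $F_C(S)$ denotes the smallest face of $C$ containing $S$; $F_C(x)=F_C(\{x\})$. Joint supporting subspace: for convex $C,D\subseteq\mathbb{R}^n$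 with $C\cap D\neq\emptyset$, $T(C,D):=\operatorname{Span} F_{C-D}(0)$ (linear span) and $T_a(C,D):=T(C,D)+(C\cap D)$. If $C\cap D=\emptyset$, then $T_a(C,D)=\emptyset$. *)

(* Defs.v *)
From mathcomp Require Export all_boot all_order all_algebra.
From mathcomp Require Export all_classical all_reals all_analysis.

Set Implicit Arguments.
Unset Strict Implicit.
Unset Printing Implicit Defensive.

Import Order.TTheory GRing.Theory Num.Theory.

Local Open Scope classical_set_scope.
Local Open Scope ring_scope.
Local Open Scope ereal_scope.

Section set_definitions.
Context {R : realType} {n : nat}.
Implicit Types (C D F S : set 'rV[R]_n) (x y z : 'rV[R]_n).

Definition minkowski_add C D : set 'rV[R]_n :=
  [set (x + y)%R | x in C & y in D].

Definition minkowski_sub C D : set 'rV[R]_n :=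
  [set (x - y)%R | x in C & y in D].

Definition segment y z : set 'rV[R]_n :=
  [set ((1 - t) *: y + t *: z)%R | t in `[0%R, 1%R]%classic].

(* Empty when y = z. *)
Definition open_segment y z : set 'rV[R]_n := segment y z `\` [set y; z].

(* A face is not required to be convex, hence neither is a member of the
   family over which [min_face] takes the intersection. *)
Definition face C F : Prop :=
  F `<=` C /\
  forall y z, C y -> C z -> open_segment y z `&` F !=set0 -> F y /\ F z.

(* Meaningful when S `<=` C: see [min_face_face]. *)
Definition min_face C S : set 'rV[R]_n := smallest (face C) S.

Definition linear_span S : set 'rV[R]_n :=
  smallest [set V : set 'rV[R]_n | GRing.submod_closed [in V]] S.

(* T(C, D), meaningful when C and D meet. *)
Definition joint_supp_space C D : set 'rV[R]_n :=
  linear_span (min_face (minkowski_sub C D) [set 0%R]).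

(* T_a(C, D); it is empty when C and D are disjoint, since adding the empty
   set yields the empty set. *)
Definition affine_joint_supp_space C D : set 'rV[R]_n :=
  minkowski_add (joint_supp_space C D) (C `&` D).

Lemma min_face_face C S : S `<=` C -> face C (min_face C S).
Proof.
move=> SC; split; first by apply: smallest_sub => //; split.
move=> y z Cy Cz [w [yzw Sw]].
have FyFz F : face C F /\ S `<=` F -> F y /\ F z.
  by move=> FS; apply: FS.1.2 => //; exists w; split=> //; exact: Sw.
by split=> F /(FyFz F)[].
Qed.

Lemma affine_joint_supp_space0 C D :
  C `&` D = set0 -> affine_joint_supp_space C D = set0.
Proof.
move=> CD0; rewrite /affine_joint_supp_space CD0.
by apply/seteqP; split=> // x [u _ [v []]].
Qed.

End set_definitions.

Section function_definitions.
Context {R : realType} {n : nat}.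
Implicit Types (f g : 'rV[R]_n -> \bar R) (S : set 'rV[R]_n).
Implicit Types (x y z : 'rV[R]_n).

Definition dotp x y : R := (\sum_(i < n) x ord0 i * y ord0 i)%R.

Definition epigraph f : set ('rV[R]_n * R^o)%type :=
  [set p | f p.1 <= (p.2)%:E].

(* Convexity through the epigraph needs no convention for +oo - oo. *)
Definition ereal_convex f : Prop := convex_set (epigraph f).

Definition effective_dom f : set 'rV[R]_n := [set x | f x != +oo].

Definition proper_fun f : Prop :=
  (forall x, f x != -oo) /\ effective_dom f !=set0.

Definition set_indicator S x : \bar R := if x \in S then 0 else +oo.

Definition conjugate f y : \bar R :=
  ereal_sup [set (dotp y x)%:E - f x | x in [set: 'rV[R]_n]].

Definition infconv f g z : \bar R :=
  ereal_inf [set f p.1 + g p.2 | p in [set p | (p.1 + p.2)%R = z]].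

End function_definitions.

(* Main.v *)
Require Import Defs.
From mathcomp Require Import ring lra.

(** Write [A] and [B] for the effective domains of [f] and [g], and [E] for
    [A - B].

    If [A] and [B] are disjoint, then [Ta] is empty, so that [f + g] and both
    functions with the indicator added are constantly [+oo]; their conjugates
    are constantly [-oo], and any splitting of [z] is optimal.

    Otherwise [0] lies in [E], and the smallest face of [E] containing [0]
    consists of the points of [E] at which one can also move a little in the
    opposite direction without leaving [E]. Its span [T] is therefore exactly
    the set of [d] such that both [e d] and [- e d] lie in [E] for some [e > 0]
    ([span_min_face0]). Since [A] and [B] meet inside [Ta], adding the indicator
    of [Ta] to both functions does not change [f + g]. What it buys is a
    qualification condition: every difference of a point of [A] and a point of
    [B] taken inside [Ta] has a positive multiple of its opposite which is again
    such a difference ([joint_domain_sym]). In other words [0] is in the relative interior of the difference of the restricted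
    domains.

    Under that condition Fenchel duality holds with attainment
    ([fenchel_duality]). Let [p] be the value of the conjugate of [f + g] at
    [z]; only a finite [p] needs an argument, and then one may consider the convex cone generated by the pairs
    [(a - b, f a + g b - <z, a> + p)]. It meets the axis over [0] only at
    nonnegative heights, because [<z, x> - f x - g x <= p] for all [x], and its
    projection is a linear subspace, by the qualification condition. An
    algebraic Hahn-Banach argument, one coordinate at a time, puts a linear
    form [w] below this cone ([cone_linear_minorant]), and [z + w] and [- w] are
    then the wanted splitting of [z]. The opposite inequality between
    the conjugates is the Fenchel-Young inequality ([conjugate_add_le]). *)

Set Implicit Arguments.
Unset Strict Implicit.
Unset Printing Implicit Defensive.

Import Order.TTheory GRing.Theory Num.Theory.

Local Open Scope classical_set_scope.
Local Open Scope ring_scope.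
Local Open Scope ereal_scope.

(** * The scalar product *)

Section dot_product.
Context {R : realType} {n : nat}.
Implicit Types x y z : 'rV[R]_n.
Local Open Scope ring_scope.

Lemma dotpDl x y z : dotp (x + y) z = dotp x z + dotp y z.
Proof.
by rewrite /dotp -big_split; apply: eq_bigr => i _; rewrite mxE mulrDl.
Qed.

Lemma dotpDr x y z : dotp x (y + z) = dotp x y + dotp x z.
Proof.
by rewrite /dotp -big_split; apply: eq_bigr => i _; rewrite mxE mulrDr.
Qed.

Lemma dotpZl a x y : dotp (a *: x) y = a * dotp x y.
Proof.
by rewrite /dotp mulr_sumr; apply: eq_bigr => i _; rewrite mxE mulrA.
Qed.

Lemma dotpZr a x y : dotp x (a *: y) = a * dotp x y.
Proof.
by rewrite /dotp mulr_sumr; apply: eq_bigr => i _; rewrite mxE mulrCA.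
Qed.

Lemma dotpNl x y : dotp (- x) y = - dotp x y.
Proof. by rewrite -scaleN1r dotpZl mulN1r. Qed.

Lemma dotpNr x y : dotp x (- y) = - dotp x y.
Proof. by rewrite -scaleN1r dotpZr mulN1r. Qed.

Lemma dotp0r x : dotp x 0 = 0.
Proof. by rewrite -(scale0r 0) dotpZr mul0r. Qed.

Lemma dotp_delta (i : 'I_n) x : dotp (delta_mx ord0 i) x = x ord0 i.
Proof.
rewrite /dotp (bigD1 i) //= big1 => [|j ji]; last first.
  by rewrite mxE (negbTE ji) mul0r.
by rewrite mxE !eqxx mul1r addr0.
Qed.

End dot_product.

(** * Linear minorants of convex cones *)

Section linear_minorant.
Context {R : realType} {n : nat}.
Local Open Scope ring_scope.
Variable K : set ('rV[R]_n * R).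
Hypothesis KD : forall d e r s, K (d, r) -> K (e, s) -> K (d + e, r + s).
Hypothesis KZ : forall a d r, 0 < a -> K (d, r) -> K (a *: d, a * r).
Hypothesis Ksym : forall d r, K (d, r) -> exists s, K (- d, s).
Hypothesis K0 : forall r, K (0, r) -> 0 <= r.

Let low (k : nat) (d : 'rV[R]_n) := forall i : 'I_n, (k <= i)%N -> d ord0 i = 0.

(** The one-dimensional extension step of Hahn-Banach: the slope given to the
    new coordinate must be at most every quotient coming from pairs with a
    positive coordinate, and at least every one coming from pairs with a
    negative coordinate. Adding a normalised pair of each kind eliminates the
    coordinate, so that the form already built shows the two requirements to
    be compatible; the infimum of the upper bounds serves as slope. *)
Let minorant_step (w : 'rV[R]_n) (i : 'I_n) :
  (forall d r, K (d, r) -> low i d -> dotp w d <= r) ->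
  exists w', forall d r, K (d, r) -> low i.+1 d -> dotp w' d <= r.
Proof.
move=> wP.
pose S := [set p.2 - dotp w p.1 |
  p in [set p | [/\ K p, low i.+1 p.1 & p.1 ord0 i = 1]]].
(* [S] collects the upper bounds on the new slope, normalised so that the
   coordinate is 1; the lower bounds come from the coordinate -1. *)
have Slb d r : K (d, r) -> low i.+1 d -> d ord0 i = -1 ->
    lbound S (dotp w d - r).
  move=> Kd ld di _ [[e s]/= [Ke le ei] <-].
  have : low i (d + e).
    move=> j; rewrite leq_eqVlt => /predU1P[/val_inj <-|ij]; rewrite mxE.
      by rewrite di ei addNr.
    by rewrite ld // le // addr0.
  by move=> /(wP _ _ (KD Kd Ke)); rewrite dotpDr; lra.
have lowN d : low i.+1 d -> low i.+1 (- d).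
  by move=> ld j ij; rewrite mxE ld // oppr0.
have lowZ a d : low i.+1 d -> low i.+1 (a *: d).
  by move=> ld j ij; rewrite mxE ld // mulr0.
exists (w + inf S *: delta_mx ord0 i) => d r Kd ld.
rewrite dotpDl dotpZl dotp_delta.
have [di|di|di] := ltrgt0P (d ord0 i).
- have di1 : (d ord0 i)^-1 * d ord0 i = 1 by rewrite mulVf ?gt_eqF.
  have Kd' : K ((d ord0 i)^-1 *: d, (d ord0 i)^-1 * r).
    by apply: KZ => //; rewrite invr_gt0.
  (* Symmetry provides a lower bound on [S], without which [inf S] means
     nothing. *)
  have [s Ks] := Ksym Kd'.
  have : inf S <= (d ord0 i)^-1 * r - dotp w ((d ord0 i)^-1 *: d).
    apply: ge_inf.
      exists (dotp w (- ((d ord0 i)^-1 *: d)) - s); apply: Slb => //.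
        exact/lowN/lowZ.
      by rewrite !mxE di1.
    exists ((d ord0 i)^-1 *: d, (d ord0 i)^-1 * r) => //.
    by split=> //=; [exact: lowZ|rewrite mxE].
  rewrite dotpZr -mulrBr -(ler_pM2l di) mulrA mulfV ?gt_eqF //; lra.
- have ndi : 0 < - d ord0 i by rewrite oppr_gt0.
  have Kd' : K ((- d ord0 i)^-1 *: d, (- d ord0 i)^-1 * r).
    by apply: KZ => //; rewrite invr_gt0.
  have di1 : (- d ord0 i)^-1 * d ord0 i = -1.
    by rewrite invrN mulNr mulVf ?lt_eqF.
  (* Here symmetry provides an element of [S]. *)
  have [s Ks] := Ksym Kd'.
  have : dotp w ((- d ord0 i)^-1 *: d) - (- d ord0 i)^-1 * r <= inf S.
    apply: lb_le_inf.
      exists (s - dotp w (- ((- d ord0 i)^-1 *: d))).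
      exists (- ((- d ord0 i)^-1 *: d), s) => //; split=> //=.
        exact/lowN/lowZ.
      by rewrite !mxE di1 opprK.
    by apply: Slb => //; [exact: lowZ|rewrite mxE].
  rewrite dotpZr -mulrBr -(ler_pM2l ndi) mulrA mulfV ?gt_eqF //; lra.
- rewrite di mulr0 addr0; apply: wP => // j.
  by rewrite leq_eqVlt => /predU1P[/val_inj <-|/ld].
Qed.

(** An algebraic Hahn-Banach theorem. Hypothesis [Ksym] says that the projection
    of the cone is a linear subspace, so that [0] is in the relative interior
    of the projection: this is what rules out a vertical separating
    hyperplane. *)
Lemma cone_linear_minorant :
  exists w, forall d r, K (d, r) -> dotp w d <= r.
Proof.
suff H k : (k <= n)%N ->
    exists w, forall d r, K (d, r) -> low k d -> dotp w d <= r.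
  have [w wP] := H n (leqnn n); exists w => d r Kd; apply: wP => // i.
  by rewrite leqNgt ltn_ord.
elim: k => [_|k IHk kn]; last first.
  have [w wP] := IHk (ltnW kn).
  exact: (@minorant_step w (Ordinal kn)).
exists 0 => d r Kd d0; have {}d0 : d = 0.
  by apply/rowP => i; rewrite d0 // mxE.
by move: Kd; rewrite d0 dotp0r => /K0.
Qed.

End linear_minorant.

(** * Convex combinations *)

Section convexity.
Context {R : realType}.
Local Open Scope ring_scope.

(** Unnormalised weights suit the cone arguments below, where the natural
    weights do not sum to 1. *)
Lemma convex_set_weights (V : lmodType R) (C : set V) : convex_set C ->
  forall x y a b, 0 <= a -> 0 <= b -> 0 < a + b -> C x -> C y ->
  C ((a + b)^-1 *: (a *: x + b *: y)).
Proof.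
move=> convC x y a b a0 b0 ab0 Cx Cy.
have t0 : 0 <= (a + b)^-1 * a by rewrite mulr_ge0 // invr_ge0 ltW.
have t1 : (a + b)^-1 * a <= 1 by rewrite mulrC ler_pdivrMr // mul1r lerDl.
have := convC x y (@Itv01 R _ t0 t1).
rewrite !inE => /(_ Cx Cy); congr C.
rewrite /conv /= scalerDr !scalerA; congr (_ + _ *: _).
by rewrite /unstable.onem; field; rewrite gt_eqF.
Qed.

End convexity.

(** * The smallest face through the origin *)

Section faces.
Context {R : realType} {n : nat}.
Implicit Types (C D E : set 'rV[R]_n) (x y d : 'rV[R]_n).
Local Open Scope ring_scope.

Lemma convex_set_sub C D :
  convex_set C -> convex_set D -> convex_set (minkowski_sub C D).
Proof.
move=> convC convD x y t; rewrite !inE => -[a Ca [b Db <-]] [a' Ca' [b' Db' <-]].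
have := convC a a' t; rewrite !inE => /(_ Ca Ca') Caa.
have := convD b b' t; rewrite !inE => /(_ Db Db') Dbb.
exists (conv t (a : convex_lmodType _) a') => //.
exists (conv t (b : convex_lmodType _) b') => //.
by rewrite /conv /= !scalerBr opprD addrACA.
Qed.

Lemma convex_set_add C D :
  convex_set C -> convex_set D -> convex_set (minkowski_add C D).
Proof.
move=> convC convD x y t; rewrite !inE => -[a Ca [b Db <-]] [a' Ca' [b' Db' <-]].
have := convC a a' t; rewrite !inE => /(_ Ca Ca') Caa.
have := convD b b' t; rewrite !inE => /(_ Db Db') Dbb.
exists (conv t (a : convex_lmodType _) a') => //.
exists (conv t (b : convex_lmodType _) b') => //.
by rewrite /conv /= !scalerDr addrACA.
Qed.

Lemma convex_setI C D :
  convex_set C -> convex_set D -> convex_set (C `&` D).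
Proof.
move=> convC convD x y t; rewrite !inE => -[Cx Dx] [Cy Dy].
by split; apply/set_mem; [apply: convC|apply: convD]; apply/mem_set.
Qed.

(** For [E] convex and containing [0], this is the largest linear subspace
    inside the cone generated by [E]. *)
Definition reversible_directions E : set 'rV[R]_n :=
  [set d | exists e : R, [/\ 0 < e, E (e *: d) & E (- (e *: d))]].

Lemma reversible_of_opposite E x k : convex_set E -> E 0 -> E x ->
  0 < k -> E (- (k *: x)) -> reversible_directions E x.
Proof.
move=> convE E0 Ex k0 ENx; have k1 : 0 < 1 + k by rewrite addr_gt0.
exists ((1 + k)^-1 * k); split; first by rewrite mulr_gt0 // invr_gt0.
  rewrite (_ : _ *: _ = (1 + k)^-1 *: (1 *: 0 + k *: x)).
    by apply: convex_set_weights => //; rewrite ltW.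
  by rewrite scaler0 add0r scalerA.
rewrite (_ : - _ = (1 + k)^-1 *: (1 *: (- (k *: x)) + k *: 0)).
  by apply: convex_set_weights => //; rewrite ltW.
by rewrite scaler0 addr0 scale1r scalerN scalerA.
Qed.

(** Closure under sums is convexity: if the segments from [- e u] to [e u] and
    from [- h v] to [h v] lie in [E], then so does a small multiple of [u + v],
    as the combination of [e u] and [h v] with weights [1 / e] and [1 / h]. *)
Lemma submod_closed_reversible E : convex_set E -> E 0 ->
  GRing.submod_closed [in reversible_directions E].
Proof.
move=> convE E0; split=> [|a u v].
  by rewrite inE; exists 1; split; rewrite // scaler0 ?oppr0.
rewrite !inE => -[e [e0 Eu ENu]] [h [h0 Ev ENv]].
have ae0 : 0 <= `|a| / e by rewrite divr_ge0 // ltW.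
have h10 : 0 < h^-1 by rewrite invr_gt0.
have wpos : 0 < `|a| / e + h^-1 by rewrite ltr_wpDl.
(* [s] is the sign of [a], which the symmetry of the condition absorbs. *)
have [s sE Es] : exists2 s : R, s * `|a| = a &
    E (s *: (e *: u)) /\ E (- (s *: (e *: u))).
  have [a0|a0] := leP 0 a.
    by exists 1; rewrite ?mul1r ?ger0_norm // scale1r.
  exists (-1); first by rewrite ltr0_norm // mulN1r opprK.
  by rewrite scaleN1r opprK.
have combE : a *: u + v =
    (`|a| / e) *: (s *: (e *: u)) + h^-1 *: (h *: v).
  rewrite !scalerA mulVf ?gt_eqF // scale1r; congr (_ *: _ + _).
  by rewrite -[LHS]sE; field; rewrite gt_eqF.
have combN : - (a *: u + v) =
    (`|a| / e) *: - (s *: (e *: u)) + h^-1 *: - (h *: v).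
  by rewrite combE opprD !scalerN.
exists (`|a| / e + h^-1)^-1; rewrite invr_gt0 wpos -scalerN combN combE.
by split=> //; apply: convex_set_weights => //; (exact: ltW || case: Es).
Qed.

(** If [w] is strictly between [y] and [z] and [- e w] is in [E], then combining
    [- e w] with [z] in such proportions that the component along [z] cancels
    gives a negative multiple of [y] in [E], and likewise for [z]. *)
Lemma face_reversible E : convex_set E -> E 0 ->
  face E (E `&` reversible_directions E).
Proof.
move=> convE E0; split=> [x []//|y z Ey Ez [w [[[t]]]]].
rewrite /= in_itv /= => /andP[t0 t1] <- /not_orP[wy wz] [_ [e [e0 _ ENw]]].
have {}t0 : 0 < t.
  rewrite lt_neqAle t0 andbT; apply/eqP => t0'; apply: wy.
  by rewrite -t0' subr0 scale1r scale0r addr0.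
have {}t1 : 0 < 1 - t.
  rewrite subr_gt0 lt_neqAle t1 andbT; apply/eqP => t1'; apply: wz.
  by rewrite t1' subrr scale1r scale0r add0r.
have end_reversible (a b : R) p q : 0 < a -> 0 < b -> E p -> E q ->
    E (- (e *: (a *: p + b *: q))) -> reversible_directions E p.
  move=> a0 b0 Ep Eq ENpq.
  have eb0 : 0 < e * b by rewrite mulr_gt0.
  have den0 : 0 < 1 + e * b by rewrite addr_gt0.
  apply: (@reversible_of_opposite _ _ ((1 + e * b)^-1 * (e * a))) => //.
    by rewrite !mulr_gt0 // invr_gt0.
  rewrite (_ : - _ = (1 + e * b)^-1 *:
      (1 *: (- (e *: (a *: p + b *: q))) + (e * b) *: q)).
    by apply: convex_set_weights => //; exact: ltW.
  by rewrite scale1r (scalerDr e) opprD !scalerA subrK scalerN scalerA.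
split; split=> //; first exact: end_reversible ENw.
by apply: end_reversible _ _ Ez Ey _; [exact: t0|exact: t1|rewrite addrC].
Qed.

(** The origin lies strictly between a nonzero [x] and [- e x], so every face
    through the origin contains them. *)
Lemma reversible_subset_min_face E : E 0 ->
  E `&` reversible_directions E `<=` min_face E [set 0].
Proof.
move=> E0 x [Ex [e [e0 Eex ENex]]] F [[FE faceF] F0].
have {}F0 : F 0 by exact: F0.
have [->//|x0] := eqVneq x 0.
suff /faceF[] : open_segment x (- (e *: x)) `&` F !=set0 by [].
exists 0; split=> //; split.
  have e1 : 0 < 1 + e by rewrite addr_gt0.
  exists (1 + e)^-1.
    rewrite /= in_itv /= invr_ge0 ltW //= invf_le1 // lerDl ltW //.
  rewrite scalerN scalerA -scalerBl [X in X *: _](_ : _ = 0) ?scale0r //.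
  by field; rewrite gt_eqF.
by case=> /esym/eqP; rewrite ?oppr_eq0 ?scaler_eq0 ?(gt_eqF e0) (negbTE x0).
Qed.

Lemma span_min_face0 E : convex_set E -> E 0 ->
  linear_span (min_face E [set 0]) = reversible_directions E.
Proof.
move=> convE E0; apply/seteqP; split.
  apply: smallest_sub; first exact: submod_closed_reversible.
  apply: (@subset_trans _ (E `&` reversible_directions E)); last exact: subIsetr.
  apply: smallest_sub; first exact: face_reversible.
  move=> _ ->; split=> //.
  by have [] := submod_closed_reversible convE E0; rewrite inE.
move=> d [e [e0 Ed ENd]] V [[V0 VZ] FV].
have : V (e *: d).
  apply: FV; apply: (reversible_subset_min_face E0); split=> //.
  by apply: (@reversible_of_opposite _ _ 1) => //; rewrite scale1r.
move=> /mem_set Ved; have := VZ e^-1 _ _ Ved V0.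
by rewrite inE addr0 scalerA mulVf ?gt_eqF // scale1r.
Qed.
End faces.

(** * Fenchel duality *)

Section duality.
Context {R : realType} {n : nat}.
Implicit Types (f g : 'rV[R]_n -> \bar R) (x y z u v : 'rV[R]_n).

Lemma ereal_convex_weights f : ereal_convex f ->
  forall x y (a b r s : R), (0 <= a)%R -> (0 <= b)%R -> (0 < a + b)%R ->
  f x <= r%:E -> f y <= s%:E ->
  f ((a + b)^-1 *: (a *: x + b *: y))%R <= ((a + b)^-1 * (a * r + b * s))%R%:E.
Proof.
move=> convf x y a b r s a0 b0 ab0 fx fy.
exact: (@convex_set_weights _ _ (epigraph f) convf (x, r) (y, s)).
Qed.

Lemma effective_domP f x :
  effective_dom f x <-> exists r : R, f x <= r%:E.
Proof.
split=> [|[r]]; last by rewrite /effective_dom /=; case: (f x).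
rewrite /effective_dom /=; case: (f x) => [r _|//|_].
  by exists r.
by exists 0%R; rewrite leNye.
Qed.

Lemma convex_effective_dom f : ereal_convex f -> convex_set (effective_dom f).
Proof.
move=> convf x y t; rewrite !inE => /effective_domP[r fx] /effective_domP[s fy].
apply/effective_domP; have := convf (x, r) (y, s) t.
by rewrite !inE => /(_ fx fy) => fxy; eexists; exact: fxy.
Qed.

Lemma add_indicator f S x : f x != -oo ->
  f x + set_indicator S x = if x \in S then f x else +oo.
Proof.
by rewrite /set_indicator; case: ifP; rewrite ?adde0 //; case: (f x).
Qed.

Lemma convex_add_indicator f S : (forall x, f x != -oo) ->
  ereal_convex f -> convex_set S ->
  ereal_convex (fun x => f x + set_indicator S x).
Proof.
move=> fNy convf convS.
have epiE (p : 'rV[R]_n * R^o) :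
    epigraph (fun x => f x + set_indicator S x) p <-> epigraph f p /\ S p.1.
  rewrite /epigraph /= add_indicator //; case: ifPn => [/set_mem|/negP] Sp.
    by split=> [|[]].
  by rewrite leye_eq; split=> // -[_ /mem_set].
move=> p q t; rewrite !inE => /epiE[fp Sp] /epiE[fq Sq]; apply/epiE; split.
  by apply/set_mem/convf; exact/mem_set.
by apply/set_mem/(convS p.1 q.1 t); exact/mem_set.
Qed.

Lemma conjugate_le f y (c : \bar R) :
  (forall x, (dotp y x)%:E - f x <= c) -> conjugate f y <= c.
Proof. by move=> H; apply: ge_ereal_sup => _ [x _ <-]. Qed.

Lemma le_conjugate f y x : (dotp y x)%:E - f x <= conjugate f y.
Proof. by apply: ereal_sup_ubound; exists x. Qed.

(** Fenchel-Young. Excluding the value [-oo] matters: [+oo - oo] is [-oo], so at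
    a point where [f] is [+oo] and [g] is [-oo] the left-hand side would be
    [+oo] while the right-hand side may be [-oo]. *)
Lemma conjugate_add_le f g u v :
  (forall x, f x != -oo) -> (forall x, g x != -oo) ->
  conjugate (fun x => f x + g x) (u + v)%R <= conjugate f u + conjugate g v.
Proof.
move=> fNy gNy; apply: conjugate_le => x.
apply: (@le_trans _ _ (((dotp u x)%:E - f x) + ((dotp v x)%:E - g x))).
  have := fNy x; have := gNy x; case: (f x) => [r||] //; case: (g x) => [s||] //.
  by rewrite dotpDl -?EFinB -?EFinD -?EFinB lee_fin => _ _; lra.
by apply: leeD; exact: le_conjugate.
Qed.

(** The last hypothesis says that the difference of the domains generates a
    linear subspace as a cone, which is the qualification condition that the
    relative interiors of the domains meet, stated without topology. *)
Lemma fenchel_duality f g : ereal_convex f -> ereal_convex g ->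
  (forall x, f x != -oo) -> (forall x, g x != -oo) ->
  effective_dom f `&` effective_dom g !=set0 ->
  (forall a b, effective_dom f a -> effective_dom g b ->
    exists (e : R) a' b', [/\ (0 < e)%R, effective_dom f a',
      effective_dom g b' & (e *: (b - a) = a' - b')%R]) ->
  forall z, exists u v, (u + v)%R = z /\
    conjugate f u + conjugate g v <= conjugate (fun x => f x + g x) z.
Proof.
move=> convf convg fNy gNy [c0 [fc0 gc0]] domsym z.
have [p_oo|p_fin] := eqVneq (conjugate (fun x => f x + g x) z) +oo.
  by exists z, 0%R; rewrite addr0 p_oo leey.
have [r0 fr0] := (effective_domP _ _).1 fc0.
have [s0 gs0] := (effective_domP _ _).1 gc0.
have [p pE] : exists p : R, conjugate (fun x => f x + g x) z = p%:E.
  have := le_conjugate (fun x => f x + g x) z c0.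
  move: p_fin; case: (conjugate _ z) => [p|//|]; first by exists p.
  move=> _; rewrite leeNy_eq; move: fr0 gs0 (fNy c0) (gNy c0).
  by case: (f c0) => // ?; case: (g c0) => // ?.
have pP x r s : f x <= r%:E -> g x <= s%:E -> (dotp z x - p <= r + s)%R.
  have := le_conjugate (fun x => f x + g x) z x; rewrite pE.
  have := fNy x; have := gNy x; case: (f x) => [r'||] //; case: (g x) => [s'||] //.
  by rewrite -EFinD lee_fin => _ _; rewrite !lee_fin; lra.
(* The cone generated by the graph of the perturbation function, shifted by [p];
   using upper bounds [r] and [s] of [f a] and [g b] instead of their values
   keeps the coordinates real. *)
pose K := [set q : 'rV[R]_n * R | exists (l : R) a b (r s : R),
  [/\ (0 < l)%R, f a <= r%:E, g b <= s%:E, q.1 = (l *: (a - b))%R &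
    q.2 = (l * (r + s - dotp z a + p))%R]].
have [w wP] : exists w, forall d r, K (d, r) -> (dotp w d <= r)%R.
  apply: cone_linear_minorant.
  - move=> d d' q q' [l [a [b [r [s [l0 fa gb /= -> ->]]]]]].
    move=> [m [a' [b' [r' [s' [m0 fa' gb' /= -> ->]]]]]].
    have lm0 : (0 < l + m)%R by rewrite addr_gt0.
    have lmV : ((l + m) * (l + m)^-1 = 1)%R by rewrite mulfV ?gt_eqF.
    exists (l + m)%R, ((l + m)^-1 *: (l *: a + m *: a'))%R,
      ((l + m)^-1 *: (l *: b + m *: b'))%R,
      ((l + m)^-1 * (l * r + m * r'))%R, ((l + m)^-1 * (l * s + m * s'))%R.
    split=> //; [by apply: ereal_convex_weights=> //; exact: ltW..| |] => /=.
      by rewrite -scalerBr scalerA lmV scale1r !scalerBr opprD addrACA.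
    rewrite dotpZr dotpDr !dotpZr.
    by field; rewrite gt_eqF.
  - move=> a _ _ a0 [l [x [y [r [s [l0 fx gy /= -> ->]]]]]].
    exists (a * l)%R, x, y, r, s; split=> //=; first by rewrite mulr_gt0.
      by rewrite scalerA.
    by rewrite mulrA.
  - move=> _ _ [l [a [b [r [s [l0 fa gb /= -> _]]]]]].
    have [||e [a' [b' [e0 fa' gb' eE]]]] := domsym a b.
    + by apply/effective_domP; exists r.
    + by apply/effective_domP; exists s.
    have [r' fr'] := (effective_domP _ _).1 fa'.
    have [s' gs'] := (effective_domP _ _).1 gb'.
    eexists; exists (l / e)%R, a', b', r', s'; split=> //=.
      by rewrite divr_gt0.
    by rewrite -eE scalerA mulfVK ?gt_eqF // -scalerN opprB.
  - move=> _ [l [a [b [r [s [l0 fa gb /= /esym/eqP abE ->]]]]]].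
    move: abE; rewrite scaler_eq0 gt_eqF //= subr_eq0 => /eqP ab.
    rewrite -ab in gb; have := pP _ _ _ fa gb.
    by move=> zp; apply: mulr_ge0; [exact: ltW|lra].
have wK a b r s : f a <= r%:E -> g b <= s%:E ->
    (dotp (z + w) a - r + (dotp (- w) b - s) <= p)%R.
  move=> fa gb; have := wP (a - b)%R (r + s - dotp z a + p)%R.
  have KK : K ((a - b)%R, (r + s - dotp z a + p)%R).
    by exists 1%R, a, b, r, s; split; rewrite //= ?scale1r ?mul1r.
  move=> /(_ KK); rewrite dotpDr dotpNr dotpDl dotpNl; lra.
exists (z + w)%R, (- w)%R; rewrite addrK pE; split=> //.
(* The inequality [wK] bounds a sum of two terms depending on [a] and on [b]
   separately. The suprema are taken one after the other; the first one is a
   real number since both domains are nonempty. *)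
have conj_f b s : g b <= s%:E ->
    conjugate f (z + w)%R <= (p - (dotp (- w) b - s))%:E.
  move=> gb; apply: conjugate_le => a.
  have := fNy a; case E : (f a) => [r||] // _; last by rewrite leNye.
  have := wK a b r s; rewrite E => /(_ (lexx _) gb).
  by rewrite -EFinB lee_fin; lra.
have := conj_f _ _ gs0; have := le_conjugate f (z + w)%R c0.
move: fr0 (fNy c0); case: (f c0) => // r _ _.
case cfE : (conjugate f (z + w)%R) => [m||] // _ _.
rewrite -leeBrDl //; apply: conjugate_le => b.
have := gNy b; case E : (g b) => [s||] // _; last by rewrite leNye.
have := conj_f b s; rewrite E => /(_ (lexx _)).
by rewrite cfE -!EFinB !lee_fin; lra.
Qed.

End duality.

(** * The joint supporting subspace *)

Section joint_supporting_subspace.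
Context {R : realType} {n : nat}.
Variables A B : set 'rV[R]_n.
Hypothesis convA : convex_set A.
Hypothesis convB : convex_set B.
Local Open Scope ring_scope.

Let E := minkowski_sub A B.
Let T := joint_supp_space A B.
Let Ta := affine_joint_supp_space A B.

Let convE : convex_set E. Proof. exact: convex_set_sub. Qed.

Let E0 : A `&` B !=set0 -> E 0.
Proof. by move=> [c [Ac Bc]]; exists c => //; exists c => //; rewrite subrr. Qed.

Lemma joint_supp_spaceE : A `&` B !=set0 -> T = reversible_directions E.
Proof. by move=> /E0; exact: span_min_face0. Qed.

Lemma submod_closed_joint_supp_space : GRing.submod_closed [in T].
Proof.
split=> [|a u v]; rewrite !inE.
  by move=> V [[]]; rewrite inE.
move=> Tu Tv V VP; have [[_ VZ] _] := VP.
have := VZ a u v; rewrite !inE; apply; [exact: Tu|exact: Tv].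
Qed.

Lemma setI_sub_affine_joint_supp_space : A `&` B `<=` Ta.
Proof.
move=> c cAB; exists 0; last by exists c => //; rewrite add0r.
by have [] := submod_closed_joint_supp_space; rewrite inE.
Qed.

Lemma convex_affine_joint_supp_space : convex_set Ta.
Proof.
apply: convex_set_add; last exact: convex_setI.
have [_ TZ] := submod_closed_joint_supp_space.
have T0 : 0 \in T by have [] := submod_closed_joint_supp_space.
move=> x y t Tx Ty; apply: (TZ _ _ _ Tx).
by rewrite -[X in X \in _]addr0; apply: TZ.
Qed.

(** [Ta] is a single translate of [T]: the difference of two points of the
    intersection lies in [E] together with its opposite, hence in [T]. *)
Lemma affine_joint_supp_spaceB x y : Ta x -> Ta y -> T (x - y).
Proof.
move=> [u Tu [c [Ac Bc] <-]] [v Tv [d [Ad Bd] <-]].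
have [_ TZ] := submod_closed_joint_supp_space.
have Tcd : T (c - d).
  rewrite joint_supp_spaceE; last by exists c.
  exists 1; rewrite scale1r opprB; split=> //.
    by exists c => //; exists d.
  by exists d => //; exists c.
rewrite opprD addrACA -(scale1r (u - v)) -scaleN1r (addrC u).
apply/set_mem/TZ; last exact/mem_set.
by apply: TZ; exact/mem_set.
Qed.

(** As [a - b] is in [T], some [- e (a - b)] is a difference [a1 - b1] of points
    of the full domains. Then [e a + a1 = e b + b1], and dividing by [e + 1]
    gives a point [c] of both domains, which is in [Ta]. Since [c] divides the
    segment from [a] to [a1] as well as the one from [b] to [b1], the points
    [a1] and [b1] are in [Ta] too. *)
Lemma joint_domain_sym a b : A `&` B !=set0 ->
  (A `&` Ta) a -> (B `&` Ta) b ->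
  exists (e : R) a' b', [/\ 0 < e, (A `&` Ta) a', (B `&` Ta) b' &
    e *: (b - a) = a' - b'].
Proof.
move=> AB0 [Aa Taa] [Bb Tab].
have := affine_joint_supp_spaceB Taa Tab.
rewrite joint_supp_spaceE // => -[e [e0 _ [a1 Aa1 [b1 Bb1 ab1E]]]].
have abE : e *: a + a1 = e *: b + b1.
  by rewrite -(subrK b1 a1) ab1E scalerBr opprB addrA [e *: a + _]addrC subrK.
have e1 : 0 < e + 1 by rewrite addr_gt0.
pose c := (e + 1)^-1 *: (e *: a + 1 *: a1).
have Ac : A c by apply: convex_set_weights => //; exact: ltW.
have Bc : B c.
  rewrite /c scale1r abE -(scale1r b1).
  by apply: convex_set_weights => //; exact: ltW.
have cE : (e + 1) *: c = e *: a + a1.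
  by rewrite scalerA mulfV ?gt_eqF // !scale1r.
have Tac : Ta c by apply: setI_sub_affine_joint_supp_space.
have Ta_reflect x x1 : Ta x -> e *: x + x1 = (e + 1) *: c -> Ta x1.
  move=> Tax xE; exists (e *: (c - x)); last first.
    exists c => //; rewrite scalerBr addrAC -{2}(scale1r c) -scalerDl -xE.
    by rewrite addrAC subrr add0r.
  have [T0 TZ] := submod_closed_joint_supp_space.
  rewrite -(addr0 (_ *: _)); apply/set_mem/TZ => //.
  by apply/mem_set; exact: affine_joint_supp_spaceB.
exists e, a1, b1; split=> //.
- by split=> //; apply: Ta_reflect Taa _; rewrite cE.
- by split=> //; apply: Ta_reflect Tab _; rewrite cE abE.
- by rewrite ab1E -scalerN opprB.
Qed.

End joint_supporting_subspace.

(** * The conjugate of a sum *)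

Theorem corollary5p4 (R : realType) (n : nat) (f g : 'rV[R]_n -> \bar R)
    (f_convex : ereal_convex f) (f_proper : proper_fun f)
    (g_convex : ereal_convex g) (g_proper : proper_fun g) :
  let Ta := affine_joint_supp_space (effective_dom f) (effective_dom g) in
  let fT := (fun x => f x + set_indicator Ta x) in
  let gT := (fun x => g x + set_indicator Ta x) in
  conjugate (fun x => f x + g x) = infconv (conjugate fT) (conjugate gT) /\
  forall z : 'rV[R]_n, exists u v : 'rV[R]_n,
    (u + v)%R = z /\
    infconv (conjugate fT) (conjugate gT) z = conjugate fT u + conjugate gT v.
Proof.
move=> Ta fT gT.
have [fNy _] := f_proper; have [gNy _] := g_proper.
have indNy (h : 'rV[R]_n -> \bar R) x :
    (forall x, h x != -oo) -> h x + set_indicator Ta x != -oo.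
  by move=> hNy; rewrite add_indicator //; case: ifP.
have fTNy x : fT x != -oo by exact: indNy.
have gTNy x : gT x != -oo by exact: indNy.
have dom_ind (h : 'rV[R]_n -> \bar R) : (forall x, h x != -oo) ->
    effective_dom (fun x => h x + set_indicator Ta x) = effective_dom h `&` Ta.
  move=> hNy; apply/funext => x; apply/propext; rewrite /effective_dom /=.
  rewrite add_indicator //; case: ifPn => [/set_mem|/negP] Tx.
    by split=> [|[]].
  by split=> [/eqP //|[_ /mem_set]].
have sumE : (fun x => f x + g x) = (fun x => fT x + gT x).
  apply/funext => x; rewrite /fT /gT !add_indicator //.
  case: ifPn => // /negP Tx.
  have : ~ (f x != +oo /\ g x != +oo).
    by move=> fgx; apply: Tx; rewrite inE; exact: setI_sub_affine_joint_supp_space.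
  move=> /not_andP[] /negP; rewrite negbK => /eqP ->.
    by move: (gNy x); case: (g x).
  by move: (fNy x); case: (f x).
have attained z : exists u v, (u + v)%R = z /\
    conjugate fT u + conjugate gT v <= conjugate (fun x => f x + g x) z.
  have [domfg|domfg] := eqVneq (effective_dom f `&` effective_dom g) set0.
    exists z, 0%R; rewrite addr0; split=> //.
    rewrite [X in X + _](_ : _ = -oo) ?addNye ?leNye //.
    apply/eqP; rewrite -leeNy_eq; apply: conjugate_le => x.
    rewrite /fT add_indicator // /Ta affine_joint_supp_space0 //.
    by rewrite ifF // in_set0.
  move/set0P : domfg => domfg.
  have convf := convex_effective_dom f_convex.
  have convg := convex_effective_dom g_convex.
  have convTa := convex_affine_joint_supp_space convf convg.
  rewrite sumE; apply: fenchel_duality => //.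
  - exact: convex_add_indicator.
  - exact: convex_add_indicator.
  - rewrite !dom_ind //; have [c cfg] := domfg; exists c.
    have Tac := setI_sub_affine_joint_supp_space cfg.
    by split; split=> //; case: cfg.
  - rewrite !dom_ind // => a b; exact: joint_domain_sym.
have infconv_ge z :
    conjugate (fun x => f x + g x) z <= infconv (conjugate fT) (conjugate gT) z.
  apply: le_ereal_inf_tmp => _ [[u v] /= <- <-].
  by rewrite sumE; exact: conjugate_add_le.
have infconv_le u v : infconv (conjugate fT) (conjugate gT) (u + v)%R <=
    conjugate fT u + conjugate gT v.
  by apply: ereal_inf_lbound; exists (u, v).
split=> [|z].
  apply/funext => z; apply/eqP; rewrite eq_le infconv_ge /=.
  have [u [v [<- uvz]]] := attained z.
  exact: le_trans (infconv_le u v) uvz.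
have [u [v [uvz uv_le]]] := attained z; exists u, v; split=> //.
apply/eqP; rewrite eq_le -{1}uvz infconv_le /=.
exact: le_trans uv_le (infconv_ge z).
Qed.
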